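(* Let $n\ge1$ and let $Q$ be any linear projection from the edge space $E_n$ of the Laakso graph $\mathcal{L}_n$ onto its cycle space $Z_n$. Then the operator norm of $Q$ on $(E_n,\|\cdot\|_1)$ satisfies $\|Q\|_1\ge\frac38(n+1)$.
   Context: Laakso graphs (oriented): $\mathcal{L}_0$ is a single oriented edge. $\mathcal{L}_1$ has vertices $b$ (bottom)$,u,p,q,v,t$ (top) and oriented edges $b\to u$, $u\to p$, $p\to v$, $u\to q$, $q\to v$, $v\to t$. For $n\ge1$, $\mathcal{L}_n$ is obtained from $\mathcal{L}_{n-1}$ by replacing each oriented edge by a copy of $\mathcal{L}_1$, its bottom identified with the tail and its top with the head of the edge. $E_n=\mathbb{R}^{E(\mathcal{L}_n)}$ is the edge space, with $\|x\|_1=\sum_e|x(e)|$. The cycle space $Z_n\subset E_n$ is the linear span of the signed indicator functions of cycles of $\mathcal{L}_n$ (for a cycle traversed in a fixed direction: value $1$ on edges of the cycle whose orientation agrees with the direction, $-1$ on edges of the cycle whose orientation disagrees, $0$ on edges not in the cycle). *)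

(* Defs.v *)
From HB Require Import structures.
From mathcomp Require Import all_boot all_order all_algebra.
From mathcomp Require Import classical_sets reals.
Set Implicit Arguments.
Unset Strict Implicit.
Unset Printing Implicit Defensive.
Import Order.TTheory GRing.Theory Num.Theory.
Local Open Scope ring_scope.

Record ograph := OGraph {
  vert : finType;
  edge : finType;
  etail : edge -> vert;
  ehead : edge -> vert }.

(* The terminals of L_1 are kept apart from its inner vertices, because edge
   replacement identifies the former with old vertices and creates fresh copies
   of the latter. *)
Variant l1_inner := L1u | L1p | L1q | L1v.

Definition l1_inner_code (x : l1_inner) : 'I_4 :=
  match x with
  | L1u => inord 0 | L1p => inord 1 | L1q => inord 2 | L1v => inord 3
  end.

Definition l1_inner_decode (i : 'I_4) : l1_inner :=
  match val i with 0 => L1u | 1 => L1p | 2 => L1q | _ => L1v end.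

Lemma l1_inner_codeK : cancel l1_inner_code l1_inner_decode.
Proof. by case; rewrite /l1_inner_decode /= inordK. Qed.

HB.instance Definition _ := Finite.copy l1_inner (can_type l1_inner_codeK).

Variant l1_vert := L1b | L1t | L1in of l1_inner.

Variant l1_edge := L1bu | L1up | L1pv | L1uq | L1qv | L1vt.

Definition l1_edge_code (e : l1_edge) : 'I_6 :=
  match e with
  | L1bu => inord 0 | L1up => inord 1 | L1pv => inord 2
  | L1uq => inord 3 | L1qv => inord 4 | L1vt => inord 5
  end.

Definition l1_edge_decode (i : 'I_6) : l1_edge :=
  match val i with
  | 0 => L1bu | 1 => L1up | 2 => L1pv | 3 => L1uq | 4 => L1qv | _ => L1vt
  end.

Lemma l1_edge_codeK : cancel l1_edge_code l1_edge_decode.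
Proof. by case; rewrite /l1_edge_decode /= inordK. Qed.

HB.instance Definition _ := Finite.copy l1_edge (can_type l1_edge_codeK).

Definition l1_tail (e : l1_edge) : l1_vert :=
  match e with
  | L1bu => L1b
  | L1up => L1in L1u
  | L1pv => L1in L1p
  | L1uq => L1in L1u
  | L1qv => L1in L1q
  | L1vt => L1in L1v
  end.

Definition l1_head (e : l1_edge) : l1_vert :=
  match e with
  | L1bu => L1in L1u
  | L1up => L1in L1p
  | L1pv => L1in L1v
  | L1uq => L1in L1q
  | L1qv => L1in L1v
  | L1vt => L1t
  end.

Section EdgeReplacement.
Variable G : ograph.

(* The vertex x of the copy of L_1 that replaces the edge e. *)
Definition l1_place (e : edge G) (x : l1_vert) : vert G + edge G * l1_inner :=
  match x with
  | L1b => inl (etail e)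
  | L1t => inl (ehead e)
  | L1in y => inr (e, y)
  end.

Definition l1_replace : ograph :=
  @OGraph (vert G + edge G * l1_inner)%type (edge G * l1_edge)%type
    (fun a => l1_place a.1 (l1_tail a.2))
    (fun a => l1_place a.1 (l1_head a.2)).

End EdgeReplacement.

Definition single_edge : ograph :=
  @OGraph bool unit (fun=> false) (fun=> true).

Fixpoint laakso (n : nat) : ograph :=
  if n is m.+1 then l1_replace (laakso m) else single_edge.

Section CycleSpace.
Variables (R : realType) (G : ograph).

(* A dart (e, d) is the edge e traversed along its orientation if d = true, and
   against it if d = false. *)
Definition dart : finType := (edge G * bool)%type.

Definition dart_src (a : dart) : vert G := if a.2 then etail a.1 else ehead a.1.
Definition dart_tgt (a : dart) : vert G := if a.2 then ehead a.1 else etail a.1.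

(* Distinctness of the edges excludes running along an edge and back. *)
Definition is_cycle (c : seq dart) : bool :=
  [&& c != [::],
      cycle (fun a a' => dart_tgt a == dart_src a') c,
      uniq (map dart_src c) &
      uniq (map fst c)].

Definition edge_space : Type := {ffun edge G -> R^o}.
HB.instance Definition _ := Vector.on edge_space.

Definition cycle_indicator (c : seq dart) : edge_space :=
  [ffun e => if (e, true) \in c then 1 else if (e, false) \in c then -1 else 0].

(* A cycle has at most #|edge G| darts, since its edges are distinct, so the
   sum below ranges over all the cycles. *)
Definition cycle_space : {vspace edge_space} :=
  (\sum_(k < #|edge G|.+1) \sum_(c : k.-tuple dart | is_cycle c)
     <[cycle_indicator c]>)%VS.

Definition norm1 (x : edge_space) : R := \sum_(e : edge G) `|x e|.

Definition is_projection_onto (Q : 'End(edge_space)) (Z : {vspace edge_space}) :=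
  (Q \o Q)%VF = Q /\ limg Q = Z.

(* The set is nonempty and, the edge space being finite-dimensional, bounded, so
   sup does not take its default value. *)
Definition op_norm1 (Q : 'End(edge_space)) : R :=
  sup [set norm1 (Q x) | x in [set x | norm1 x <= 1]]%classic.

End CycleSpace.

(* Main.v *)
Require Import Defs.
From mathcomp Require Import all_boot all_order all_algebra.
From mathcomp Require Import reals.
From mathcomp Require Import ring lra.
Import Order.TTheory GRing.Theory Num.Theory.
Local Open Scope ring_scope.

Set Implicit Arguments.
Unset Strict Implicit.
Unset Printing Implicit Defensive.

(* Trace duality. If T maps the cycle space Z to itself, then the trace of T Q
   is the trace of T on Z, and it is at most ||Q||_1 times the sum over the
   edges e of the norm of the e-th row of T, as a functional on Z. This row may
   be changed by any gradient (tension), since gradients vanish on Z.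

   An edge of L_n is a word of length n in the six edges of L_1, four of which
   lie on the circle u p v q. Each proper prefix g of such words gives a cycle
   of Z: the unit flow from u to v through one side of the copy of L_1 at g,
   minus the symmetric flow through the other side. T is the sum over all g of
   these flows, tensored with the functional equal to 1 and -1 on the two sides,
   weighted by 2^-(number of circle letters of g); it has trace of order n 4^n.
   Its rows are sums of up to n nested +-1 functions, but modulo gradients they
   all have representatives with entries bounded by 7/6 (after normalization),
   and the total norm of the rows is of order 4^n. *)

(** * Computing with the letters of L_1 *)

Lemma l1_edge_eqE (a b : l1_edge) : (a == b) =
  match a, b with
  | L1bu, L1bu | L1up, L1up | L1pv, L1pv
  | L1uq, L1uq | L1qv, L1qv | L1vt, L1vt => true
  | _, _ => false
  end.
Proof. by case: eqP => [->|]; case: a; case: b. Qed.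

Lemma l1_inner_eqE (x y : l1_inner) : (x == y) =
  match x, y with
  | L1u, L1u | L1p, L1p | L1q, L1q | L1v, L1v => true
  | _, _ => false
  end.
Proof. by case: eqP => [->|]; case: x; case: y. Qed.

Lemma big_l1_edge (V : nmodType) (F : l1_edge -> V) :
  \sum_a F a = F L1bu + F L1up + F L1pv + F L1uq + F L1qv + F L1vt.
Proof.
have enumE : perm_eq (index_enum l1_edge)
    [:: L1bu; L1up; L1pv; L1uq; L1qv; L1vt].
  apply: uniq_perm; first exact: index_enum_uniq.
    by rewrite /= !inE !l1_edge_eqE.
  by move=> a; rewrite mem_index_enum !inE !l1_edge_eqE; case: a.
by rewrite (perm_big _ enumE) !big_cons big_nil /= addr0 !addrA.
Qed.

(** * Walks with endpoints *)

Section Walks.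
Variable G : ograph.
Implicit Types (c : seq (dart G)) (x y z : vert G).

(** Unlike [cycle], a walk with named endpoints can be concatenated, and potential differences
    telescope along it. *)
Fixpoint walk x y c : bool :=
  if c is a :: c' then (x == dart_src a) && walk (dart_tgt a) y c' else x == y.

Lemma walk_cat x y z c c' :
  walk x y c -> walk y z c' -> walk x z (c ++ c').
Proof.
elim: c x => [|a c IHc] x /=; first by move/eqP->.
by move=> /andP[-> /= xyc] /(IHc _ xyc).
Qed.

Lemma cycle_walk (a : dart G) c :
  cycle (fun b b' : dart G => dart_tgt b == dart_src b') (a :: c) =
  walk (dart_src a) (dart_src a) (a :: c).
Proof.
rewrite /= eqxx /=; move: {2 4}a => b.
by elim: c a => [|a' c IHc] a /=; rewrite ?andbT // IHc.
Qed.

Lemma sum_walk (V : zmodType) (pot : vert G -> V) x y c :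
  walk x y c -> \sum_(a <- c) (pot (dart_tgt a) - pot (dart_src a)) =
  pot y - pot x.
Proof.
elim: c x => [|a c IHc] x /=; first by move/eqP->; rewrite big_nil subrr.
by case/andP=> /eqP-> /IHc; rewrite big_cons => ->; rewrite addrC addrA subrK.
Qed.

End Walks.

(** * Cycle space, gradients and the trace identity *)

Section CycleSpaceTheory.
Variables (R : realType) (G : ograph).
Implicit Types (z : edge_space R G) (c : seq (dart G)).

Definition pairing (w : edge G -> R) z : R := \sum_f w f * z f.

Lemma pairingDl (w w' : edge G -> R) z :
  pairing (fun f => w f + w' f) z = pairing w z + pairing w' z.
Proof. by rewrite -big_split; apply: eq_bigr => f _; rewrite mulrDl. Qed.

Lemma pairingDr w (x y : edge_space R G) :
  pairing w (x + y) = pairing w x + pairing w y.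
Proof.
by rewrite -big_split; apply: eq_bigr => f _; rewrite ffunE mulrDr.
Qed.

Lemma pairingZr w (k : R) (x : edge_space R G) :
  pairing w (k *: x) = k * pairing w x.
Proof. by rewrite mulr_sumr; apply: eq_bigr => f _; rewrite ffunE mulrCA. Qed.

Lemma pairing_sumr (w : edge G -> R) (I : finType) (x : I -> R)
    (F : I -> edge_space R G) :
  pairing w (\sum_i x i *: F i) = \sum_i x i * pairing w (F i).
Proof.
under [RHS]eq_bigr do rewrite mulr_sumr.
rewrite exchange_big; apply: eq_bigr => f _ /=.
rewrite sum_ffunE mulr_sumr; apply: eq_bigr => i _.
by rewrite ffunE mulrCA.
Qed.

Lemma pairing_le (w : edge G -> R) (B : R) z :
  (forall f, `|w f| <= B) -> pairing w z <= B * norm1 z.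
Proof.
move=> wB; rewrite mulr_sumr; apply: ler_sum => f _.
by rewrite (le_trans (ler_norm _)) // normrM ler_wpM2r.
Qed.

Lemma cycle_space_ind (P : edge_space R G -> Prop) :
  P 0 -> (forall x y, P x -> P y -> P (x + y)) ->
  (forall (k : R) x, P x -> P (k *: x)) ->
  (forall c, is_cycle c -> P (cycle_indicator R c)) ->
  forall z, z \in cycle_space R G -> P z.
Proof.
move=> P0 PD PZ Pc z /memv_sumP[zk zk_in ->].
apply: (big_ind P) => // k _; have /memv_sumP[zc zc_in ->] := zk_in k isT.
apply: (big_ind P) => // c cyc.
by have /vlineP[x ->] := zc_in c cyc; apply/PZ/Pc.
Qed.

Lemma mem_cycle_indicator c :
  is_cycle c -> cycle_indicator R c \in cycle_space R G.
Proof.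
move=> cyc; have sz_c : (size c < #|edge G|.+1)%N.
  have /and4P[_ _ _ uniq_c] := cyc.
  by rewrite ltnS -(size_map fst) -(card_uniqP uniq_c) max_card.
have cyc' : is_cycle (in_tuple c) by [].
apply: (subvP (sumv_sup (Ordinal sz_c) _ (subvv _))) => //.
apply: (subvP (sumv_sup (in_tuple c) cyc' (subvv _))).
exact: memv_line.
Qed.

Lemma sum_cycle_indicator (w : edge G -> R) c : uniq (map fst c) ->
  pairing w (cycle_indicator R c) =
  \sum_(a <- c) (if a.2 then w a.1 else - w a.1).
Proof.
move=> uniq_c; rewrite /pairing.
transitivity (\sum_f \sum_(a <- c | a.1 == f) (if a.2 then w f else - w f)).
  apply: eq_bigr => f _; rewrite ffunE; elim: c uniq_c => [|[e d] c IHc] /=.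
    by rewrite big_nil mulr0.
  case/andP=> e_notin /IHc {}IHc; rewrite big_cons /= !inE.
  have [fe|ef] := eqVneq e f; last first.
    by rewrite -IHc !xpair_eqE ![f == _]eq_sym (negPf ef).
  have not_c d' : ((f, d') \in c) = false.
    apply/negP => /(map_f fst); rewrite /= -fe => e_in.
    by rewrite e_in in e_notin.
  rewrite -IHc !not_c fe !xpair_eqE eqxx mulr0 addr0.
  by case: d => /=; rewrite ?mulr1 ?mulrN1.
rewrite (exchange_big_dep xpredT) //=; apply: eq_bigr => a _.
by rewrite (big_pred1 a.1) // => f; rewrite eq_sym.
Qed.

Definition is_gradient (w : edge G -> R) : Prop :=
  exists pot : vert G -> R, forall e, w e = pot (ehead e) - pot (etail e).

(** Around a closed walk the potential differences telescope to zero. *)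
Lemma pairing_gradient w z :
  is_gradient w -> z \in cycle_space R G -> pairing w z = 0.
Proof.
case=> pot wE; move: z; apply: cycle_space_ind => [|x y px py|k x px|c].
- by rewrite /pairing big1 // => f _; rewrite ffunE mulr0.
- by rewrite pairingDr px py addr0.
- by rewrite pairingZr px mulr0.
case: c => // a c /and4P[_ cyc _ /sum_cycle_indicator->].
move: cyc; rewrite cycle_walk => /(sum_walk pot); rewrite subrr; apply: etrans.
apply: eq_bigr => -[e d] _; rewrite wE /dart_tgt /dart_src /=.
by case: d => //; rewrite opprB.
Qed.

Definition delta_edge (e : edge G) : edge_space R G := [ffun f => (f == e)%:R].

Lemma edge_space_sum z : z = \sum_e z e *: delta_edge e.
Proof.
apply/ffunP => f; rewrite sum_ffunE (bigD1 f) //= big1 => [|e ef].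
  by rewrite addr0 !ffunE eqxx /GRing.scale /= mulr1.
by rewrite !ffunE eq_sym (negPf ef) /GRing.scale /= mulr0.
Qed.

Lemma norm1_delta e : norm1 (delta_edge e) = 1.
Proof.
rewrite /norm1 (bigD1 e) //= big1 => [|f fe].
  by rewrite ffunE eqxx normr1 addr0.
by rewrite ffunE (negPf fe) normr0.
Qed.

Lemma norm1_delta_le_op (Q : 'End(edge_space R G)) e :
  norm1 (Q (delta_edge e)) <= op_norm1 Q.
Proof.
apply: ub_le_sup; last by exists (delta_edge e) => //=; rewrite norm1_delta.
(* [ub_le_sup] needs the set to be bounded: on the unit ball all coordinates are at most 1 in
   absolute value, so the norms of the images of the basis vectors add up to a bound. *)
exists (\sum_f norm1 (Q (delta_edge f))) => _ [x /= x_le1 <-].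
rewrite {1}(edge_space_sum x) linear_sum /=.
have x_le f : `|x f| <= 1.
  apply: le_trans x_le1; rewrite /norm1 (bigD1 f) //= lerDl.
  by apply: sumr_ge0.
rewrite /norm1 exchange_big; apply: ler_sum => g _ /=.
rewrite sum_ffunE (le_trans (ler_norm_sum _ _ _)) //; apply: ler_sum => f _.
by rewrite linearZ /= ffunE normrM ler_piMl.
Qed.

(* Both sides are the trace of T Q, where T = sum_i h_i (x) s_i. *)
Lemma sum_pairing_projection (Q : 'End(edge_space R G)) (I : finType)
    (h : I -> edge_space R G) (s : I -> edge G -> R) :
  is_projection_onto Q (cycle_space R G) ->
  (forall i, h i \in cycle_space R G) ->
  \sum_e pairing (fun f => \sum_i h i e * s i f) (Q (delta_edge e)) =
  \sum_i pairing (s i) (h i).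
Proof.
move=> [QQ imQ] hZ.
transitivity (\sum_i \sum_e h i e * pairing (s i) (Q (delta_edge e))).
  rewrite [RHS]exchange_big; apply: eq_bigr => e _ /=.
  under [RHS]eq_bigr do rewrite mulr_sumr.
  rewrite [RHS]exchange_big; apply: eq_bigr => f _ /=.
  by rewrite mulr_suml; apply: eq_bigr => i _; rewrite mulrA.
apply: eq_bigr => i _; rewrite -pairing_sumr; congr pairing.
have /memv_imgP[x _ hx] : h i \in limg Q by rewrite imQ.
have Qh : Q (h i) = h i by rewrite hx -[LHS]comp_lfunE QQ.
rewrite -[RHS]Qh [X in Q X]edge_space_sum linear_sum.
by apply: eq_bigr => e _; rewrite linearZ.
Qed.

End CycleSpaceTheory.

(** * Passing cycles and gradients through one edge replacement *)

Section Subdivision.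
Variables (R : realType) (G : ograph).
Implicit Types (c : seq (dart G)) (e : edge G).

Definition on_side (s : bool) (a : l1_edge) : bool :=
  match a with
  | L1bu | L1vt => true
  | L1up | L1pv => s
  | L1uq | L1qv => ~~ s
  end.

Definition middle (a : l1_edge) : bool :=
  match a with L1bu | L1vt => false | _ => true end.

(** The share of a unit flow from b to t carried by each letter when it splits evenly at u. *)
Definition mu (a : l1_edge) : R := if middle a then 1 / 2 else 1.

(** The signed indicator of the circle, traversed from u through p to v and back through q. *)
Definition chi (a : l1_edge) : R :=
  match a with
  | L1bu | L1vt => 0
  | L1up | L1pv => 1
  | L1uq | L1qv => -1
  end.

Definition lift_dart (s : bool) (a : dart G) : seq (dart (l1_replace G)) :=
  let first := if s then L1up else L1uq in
  let second := if s then L1pv else L1qv in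
  if a.2 then
    [:: ((a.1, L1bu), true); ((a.1, first), true);
        ((a.1, second), true); ((a.1, L1vt), true)]
  else
    [:: ((a.1, L1vt), false); ((a.1, second), false);
        ((a.1, first), false); ((a.1, L1bu), false)].

Definition lift_walk s c : seq (dart (l1_replace G)) :=
  flatten (map (lift_dart s) c).

Lemma mem_lift_dart s a e b d :
  (((e, b), d) \in lift_dart s a) = ((e, d) == a) && on_side s b.
Proof.
case: a => e' d'; rewrite /lift_dart /= xpair_eqE.
case: d'; case: d; rewrite /= !inE !xpair_eqE /= ?andbF ?andbT //=;
  by case: (e == e') => //; case: s; rewrite /= !l1_edge_eqE; case: b.
Qed.

Lemma mem_lift_walk s c e b d :
  (((e, b), d) \in lift_walk s c) = ((e, d) \in c) && on_side s b.
Proof.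
elim: c => // a c IHc.
by rewrite /lift_walk /= mem_cat mem_lift_dart IHc in_cons andb_orl.
Qed.

Lemma lift_walk_walk s c (x y : vert G) : walk x y c ->
  @walk (l1_replace G) (inl x) (inl y) (lift_walk s c).
Proof.
elim: c x => [|a c IHc] x /=; first by move/eqP->.
case/andP=> /eqP-> /IHc; apply: walk_cat.
by case: a => e []; case: s {IHc}; rewrite /= /dart_src /dart_tgt /= !eqxx.
Qed.

Lemma lift_dart_src s a (x : vert (l1_replace G)) :
  x \in map (@dart_src _) (lift_dart s a) ->
  match x with inl v => v = dart_src a | inr (e, _) => e = a.1 end.
Proof. by case: a => e []; case: s; rewrite /= !inE => /or4P[] /eqP->. Qed.

Lemma uniq_lift_dart_src s a : uniq (map (@dart_src _) (lift_dart s a)).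
Proof.
case: a => e []; case: s; rewrite /= !inE /dart_src /=;
  by rewrite /eq_op /= !xpair_eqE !l1_inner_eqE /= ?andbF.
Qed.

Lemma uniq_lift_dart_edges s a : uniq (map fst (lift_dart s a)).
Proof.
by case: a => e []; case: s; rewrite /= !inE !xpair_eqE !l1_edge_eqE /= ?andbF.
Qed.

Lemma lift_walk_src s c (x : vert (l1_replace G)) :
  x \in map (@dart_src _) (lift_walk s c) ->
  match x with
  | inl v => v \in map (@dart_src _) c
  | inr (e, _) => e \in map fst c
  end.
Proof.
case/mapP=> a' /flatten_mapP[a ac a'a] xE.
have := @lift_dart_src s a x; rewrite {1}xE map_f // => /(_ isT) {xE}.
by case: x => [v ->|[e y] ->]; apply: map_f.
Qed.

Lemma lift_walk_edges s c (f : edge (l1_replace G)) :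
  f \in map fst (lift_walk s c) -> f.1 \in map fst c.
Proof.
case/mapP=> -[[e b] d] /=; rewrite mem_lift_walk => /andP[/(map_f fst)] /=.
by move=> e_in _ ->.
Qed.

(** Old vertices on the lift are sources of [c], and fresh ones lie in copies at edges of [c]; both
    uniqueness conditions on [c] therefore enter the uniqueness of the lifted sources. *)
Lemma lift_walk_cycle s c : is_cycle c -> is_cycle (lift_walk s c).
Proof.
case: c => // a c /and4P[_ cyc uniq_src uniq_edge].
have lift_cons : lift_walk s (a :: c) != [::].
  by case: a {cyc uniq_src uniq_edge} => e [].
have lift_closed : @walk (l1_replace G) (inl (dart_src a)) (inl (dart_src a))
    (lift_walk s (a :: c)) by apply: lift_walk_walk; rewrite -cycle_walk.
apply/and4P; split=> //.
- case: (lift_walk _ _) lift_cons lift_closed => // a' c' _ closed.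
  by rewrite cycle_walk; case/andP: (closed) => /eqP <-.
- move: uniq_src uniq_edge; elim: (a :: c) => //= b c' IHc.
  case/andP=> b_notin /IHc {}IHc /andP[be_notin /IHc {}IHc].
  rewrite /lift_walk /= map_cat cat_uniq IHc uniq_lift_dart_src andbT /=.
  apply/hasPn => x /lift_walk_src x_in; apply/negP => /lift_dart_src xb.
  case: x x_in xb => [v v_in vb|[e y] e_in eb].
    by rewrite vb (negPf b_notin) in v_in.
  by rewrite eb (negPf be_notin) in e_in.
- move: uniq_edge; elim: (a :: c) => //= b c' IHc /andP[b_notin /IHc {}IHc].
  rewrite /lift_walk /= map_cat cat_uniq IHc uniq_lift_dart_edges andbT /=.
  apply/hasPn => f /lift_walk_edges; apply: contraL.
  case/mapP=> -[[e' b'] d] /=; rewrite mem_lift_dart.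
  by case/andP=> /eqP eb _ -> /=; move: b_notin; rewrite -eb.
Qed.

Definition smear (z : edge_space R G) : edge_space R (l1_replace G) :=
  [ffun f => z f.1 * mu f.2].

(** On a cycle, the even split is the mean of two lifts, one through all the p sides and one through
    all the q sides. *)
Lemma smear_cycle_space z :
  z \in cycle_space R G -> smear z \in cycle_space R (l1_replace G).
Proof.
move: z; apply: cycle_space_ind => [|x y xZ yZ|k x xZ|c cyc].
- suff -> : smear 0 = 0 by exact: mem0v.
  by apply/ffunP => f; rewrite !ffunE mul0r.
- suff -> : smear (x + y) = smear x + smear y by exact: memvD.
  by apply/ffunP => f; rewrite !ffunE mulrDl.
- suff -> : smear (k *: x) = k *: smear x by exact: memvZ.
  by apply/ffunP => f; rewrite !ffunE -mulrA.
suff -> : smear (cycle_indicator R c) =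
    (1 / 2) *: (cycle_indicator R (lift_walk true c) +
                cycle_indicator R (lift_walk false c)).
  by rewrite memvZ // memvD // mem_cycle_indicator // lift_walk_cycle.
apply/ffunP => -[e b]; rewrite !ffunE /= !mem_lift_walk /mu /GRing.scale /=.
case: ((e, true) \in c); case: ((e, false) \in c); case: b => /=; lra.
Qed.

Definition bubble e : edge_space R (l1_replace G) :=
  [ffun f => if f.1 == e then chi f.2 else 0].

Lemma bubble_cycle_space e : bubble e \in cycle_space R (l1_replace G).
Proof.
pose c : seq (dart (l1_replace G)) :=
  [:: ((e, L1up), true); ((e, L1pv), true);
      ((e, L1qv), false); ((e, L1uq), false)].
have -> : bubble e = cycle_indicator R c.
  apply/ffunP => -[e' b]; rewrite !ffunE !inE !xpair_eqE !l1_edge_eqE /=.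
  by case: (e' == e); case: b.
apply: mem_cycle_indicator.
rewrite /is_cycle /c /= /dart_tgt /dart_src /= !eqxx /= !inE !xpair_eqE.
by rewrite !l1_edge_eqE /eq_op /= /eq_op /= !l1_inner_eqE /= ?andbF.
Qed.

(** Each edge becomes paths of four edges, all carrying its old value: old potentials are multiplied
    by 4, and u, p, q, v sit at heights 1, 2, 2, 3. *)
Lemma gradient_fst (w : edge G -> R) : is_gradient w ->
  @is_gradient R (l1_replace G) (fun f => w f.1).
Proof.
case=> pot wE.
exists (fun x => match x with
  | inl v => 4 * pot v
  | inr (e, y) => 4 * pot (etail e) +
      match y with L1u => 1 | L1p | L1q => 2 | L1v => 3 end * w e
  end).
by case=> e b /=; case: b => /=; rewrite wE; ring.
Qed.

(** With zero sums along both paths, the potential can vanish at both terminals, hence everywhere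
    outside the copy. *)
Lemma gradient_local e (y : l1_edge -> R) :
  y L1bu + y L1up + y L1pv + y L1vt = 0 ->
  y L1bu + y L1uq + y L1qv + y L1vt = 0 ->
  @is_gradient R (l1_replace G) (fun f => if f.1 == e then y f.2 else 0).
Proof.
move=> y_p y_q.
exists (fun x => match x with
  | inl v => 0
  | inr (e', x) => if e' == e then
      match x with
      | L1u => y L1bu
      | L1p => y L1bu + y L1up
      | L1q => y L1bu + y L1uq
      | L1v => - y L1vt
      end else 0
  end).
case=> e' b /=; case: b => /=; case: (e' == e); lra.
Qed.

Lemma gradientD (w w' : edge G -> R) : is_gradient w -> is_gradient w' ->
  is_gradient (fun f => w f + w' f).
Proof.
move=> [pot wE] [pot' wE']; exists (fun x => pot x + pot' x) => f.
by rewrite wE wE'; ring.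
Qed.

End Subdivision.

(** * The operator T, its rows modulo gradients, and the norm bound *)

Section LaaksoKernels.
Variable R : realType.

Fixpoint mids n : edge (laakso n) -> nat :=
  if n is m.+1 then fun e : edge (laakso m.+1) => (mids e.1 + middle e.2)%N
  else fun=> 0%N.

(** The rows of T before weighting: each common proper prefix of [e] and [f] contributes the product
    of the signs of their next letters. *)
Fixpoint nested_kernel n : edge (laakso n) -> edge (laakso n) -> R :=
  if n is m.+1 then fun e f : edge (laakso m.+1) =>
    nested_kernel e.1 f.1 + (if f.1 == e.1 then chi R e.2 * chi R f.2 else 0)
  else fun=> fun=> 0.

(* Modulo gradients, only the sums along the paths b u p v t and b u q v t
   matter. Going down from the value x on an edge to its copy of L_1, they have
   to become 4 x + 2 on the side of a and 4 x - 2 on the other side. The value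
   on a itself is 1/2, as this is the x for which the invariant x -> x needs the
   smallest bound, 7/6, on the other entries; before the first circle letter,
   where first holds, x = 0. *)
Definition flat_block (first : bool) (a b : l1_edge) : R :=
  if ~~ middle b then (if first then 1 / 6 else 7 / 6)
  else if b == a then 1 / 2
  else if on_side true a == on_side true b then 7 / 6 else - (7 / 6).

(** A circle letter of [e] rewrites only the copy in which it lies; all other entries are inherited
    from the parent edge. *)
Fixpoint flat_kernel n : edge (laakso n) -> edge (laakso n) -> R :=
  if n is m.+1 then fun e f : edge (laakso m.+1) =>
    if (f.1 == e.1) && middle e.2 then flat_block (mids e.1 == 0%N) e.2 f.2
    else flat_kernel e.1 f.1
  else fun=> fun=> 0.

Lemma sum_laaksoS n (F : edge (laakso n.+1) -> R) :
  \sum_e F e = \sum_(e : edge (laakso n)) \sum_a F (e, a).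
Proof. by rewrite pair_bigA; apply: eq_bigr => -[]. Qed.

(** Two letters of weight 1 and four of weight 1/2 give a factor 4 per position. *)
Lemma sum_half_mids n :
  \sum_(e : edge (laakso n)) (1 / 2) ^+ mids e = 4 ^+ n :> R.
Proof.
elim: n => [|n IHn]; first by rewrite (big_pred1 tt) // => -[].
rewrite sum_laaksoS exprS -IHn mulr_sumr; apply: eq_bigr => e _.
by rewrite big_l1_edge /= !addn0 !addn1 !exprS; move: (_ ^+ _) => x; lra.
Qed.

Lemma sum_half_mids0 n :
  \sum_(e : edge (laakso n)) (1 / 2) ^+ mids e * (mids e == 0%N)%:R =
  2 ^+ n :> R.
Proof.
elim: n => [|n IHn]; first by rewrite (big_pred1 tt) ?mulr1 // => -[].
rewrite sum_laaksoS exprS -IHn mulr_sumr; apply: eq_bigr => e _.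
rewrite big_l1_edge /= !addn0 !addn1 /= !mulr0.
by move: (_ * _%:R) => x; lra.
Qed.

(** There are n places for the circle letter; the four circle letters weigh 2 together, as do the
    two other letters at every other place. *)
Lemma sum_half_mids1 n :
  \sum_(e : edge (laakso n)) (1 / 2) ^+ mids e * (mids e == 1%N)%:R =
  n%:R * 2 ^+ n :> R.
Proof.
elim: n => [|n IHn]; first by rewrite mul0r big1 // => e _; rewrite mulr0.
have -> : n.+1%:R * 2 ^+ n.+1 = 2 * (n%:R * 2 ^+ n) + 2 * 2 ^+ n :> R.
  by rewrite -natr1 exprS; ring.
rewrite sum_laaksoS -IHn -sum_half_mids0 !mulr_sumr -big_split.
apply: eq_bigr => e _.
rewrite big_l1_edge /= !addn0 !addn1 eqSS !exprS.
by move: (_ ^+ _) (_ == _)%:R (_ == _)%:R => x p q; field.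
Qed.

Lemma nested_kernel_le n (e f : edge (laakso n)) :
  `|nested_kernel e f| <= (mids e)%:R.
Proof.
elim: n e f => [|n IHn] e f; first by rewrite normr0.
case: e f => e a [f b] /=; rewrite natrD.
rewrite (le_trans (ler_normD _ _)) // lerD //; case: eqP => _.
  by case: a; case: b; rewrite /= ?(mul0r, mulr0, mulr1, mul1r, mulrNN, normrN,
    normr0, normr1) ?ler01.
by rewrite normr0.
Qed.

Lemma flat_kernel_le n (e f : edge (laakso n)) : `|flat_kernel e f| <= 7 / 6.
Proof.
elim: n e f => [|n IHn] e f; first by rewrite normr0; lra.
case: e f => e a [f b] /=; case: ifP => // _; rewrite /flat_block ler_norml.
by do 4?case: ifP => _; lra.
Qed.

(** This is the value x from which the next block starts; it depends only on whether a circle letter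
    has occurred, so the flag [first] determines the block. *)
Lemma flat_kernel_diag n (e : edge (laakso n)) :
  flat_kernel e e = if mids e == 0%N then 0 else 1 / 2.
Proof.
elim: n e => // n IHn [e a] /=.
rewrite eqxx /= IHn /flat_block eqxx.
by case: (middle a); rewrite ?addn0 // addn1.
Qed.

Lemma flat_kernel_gradient n (e : edge (laakso n)) :
  is_gradient (fun f => flat_kernel e f - nested_kernel e f).
Proof.
elim: n e => [|n IHn] e; first by exists (fun=> 0) => f; rewrite /=.
case: e => e a.
(* The correction inside the copy at [e]: the block replaces the inherited constant, minus the new
   term of [nested_kernel]. Its sums along both paths vanish by the choice of [flat_block]. *)
pose y b := (if middle a then flat_block (mids e == 0%N) a b - flat_kernel e e
             else 0) - chi R a * chi R b.
have [|| pot potE] :=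
  gradientD (gradient_fst (IHn e)) (@gradient_local R _ e y _ _).
- by rewrite /y /flat_block flat_kernel_diag;
    case: a {y}; case: (_ == 0%N); rewrite /= ?l1_edge_eqE /=; lra.
- by rewrite /y /flat_block flat_kernel_diag;
    case: a {y}; case: (_ == 0%N); rewrite /= ?l1_edge_eqE /=; lra.
exists pot => -[f b]; rewrite -potE /= /y.
by case: eqP => [->|_] /=; case: (middle a); ring.
Qed.

Lemma nested_kernel_decomposition n :
  exists (I : finType) (h : I -> edge_space R (laakso n))
      (s : I -> edge (laakso n) -> R),
    [/\ forall i, h i \in cycle_space R (laakso n),
        forall e f, (1 / 2) ^+ mids e * nested_kernel e f =
                    \sum_i h i e * s i f
      & \sum_i pairing (s i) (h i) = n%:R * 4 ^+ n / 2].
Proof.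
elim: n => [|n [I [h [s [hZ hs trace]]]]].
  exists void, (fun=> 0), (fun=> fun=> 0); split=> [[]|e f|] /=.
    by rewrite mulr0 big1 // => -[].
  by rewrite big1 => [|[]] //; rewrite !mul0r.
(* The extra factor 1/2 accounts for the circle letter following the prefix, as [chi] vanishes on
   the other letters; [smear] supplies the factors of later letters. *)
pose k (e : edge (laakso n)) : R := (1 / 2) ^+ (mids e).+1.
exists (I + edge (laakso n))%type.
exists (fun i => match i with
  | inl i => smear (h i) | inr g => k g *: bubble R g end).
exists (fun i => match i with
  | inl i => fun f => s i f.1
  | inr g => fun f => if f.1 == g then chi R f.2 else 0 end).
split=> [[i|g]|[e a] [f b]|].
- exact: smear_cycle_space.
- exact/memvZ/bubble_cycle_space.
- rewrite big_sumType /= mulrDr; congr (_ + _).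
    rewrite exprD mulrAC hs mulr_suml; apply: eq_bigr => i _.
    by rewrite ffunE /= /mu mulrAC; case: (middle a).
  rewrite (bigD1 e) //= big1 => [|g ge].
    rewrite addr0 !ffunE /= eqxx /GRing.scale /= /k.
    rewrite !exprS exprD; move: (_ ^+ mids e) => x.
    by case: eqP => _; case: a; rewrite /= ?expr0 ?expr1; field.
  by rewrite !ffunE /= eq_sym (negPf ge) /GRing.scale /= mulr0 mul0r.
rewrite big_sumType /=.
(* The factor 4 is the sum of [mu] over the six letters. *)
have -> : \sum_i pairing (fun f : edge (laakso n.+1) => s i f.1) (smear (h i)) =
    4 * \sum_i pairing (s i) (h i).
  rewrite mulr_sumr; apply: eq_bigr => i _.
  rewrite /pairing sum_laaksoS mulr_sumr; apply: eq_bigr => e _.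
  by rewrite big_l1_edge !ffunE /mu /=; field.
(* [chi] paired with itself gives 4, halved by the extra factor in [k]. *)
have -> : \sum_g pairing
      (fun f : edge (laakso n.+1) => if f.1 == g then chi R f.2 else 0)
      (k g *: bubble R g) = 2 * \sum_(g : edge (laakso n)) (1 / 2) ^+ mids g.
  rewrite mulr_sumr; apply: eq_bigr => g _.
  rewrite pairingZr /pairing sum_laaksoS (bigD1 g) //=.
  rewrite [X in _ + X]big1 => [|e eg].
    rewrite big_l1_edge !ffunE /= eqxx /k exprS /GRing.scale /=.
    by move: (_ ^+ _) => x; lra.
  by rewrite big1 // => a _; rewrite /= (negPf eg) mul0r.
by rewrite trace sum_half_mids exprS -natr1; field.
Qed.

Lemma projection_norm_bound n (Q : 'End(edge_space R (laakso n))) :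
  is_projection_onto Q (cycle_space R (laakso n)) ->
  3 * n%:R * 4 ^+ n <=
  op_norm1 Q * (7 * 4 ^+ n - 7 * 2 ^+ n - n%:R * 2 ^+ n).
Proof.
move=> projQ; have [_ imQ] := projQ.
have [I [h [s [hZ hs trace]]]] := nested_kernel_decomposition n.
have := sum_pairing_projection s projQ hZ; rewrite trace => {}trace.
(* [N] takes the values 0, 1, 7/6, 7/6, ...: for at most one circle letter the unmodified row is at
   least as good as the flat one. *)
pose N m : R := 7 / 6 - 7 / 6 * (m == 0%N)%:R - 1 / 6 * (m == 1%N)%:R.
have kernel_le (e : edge (laakso n)) z : z \in cycle_space R (laakso n) ->
    pairing (nested_kernel e) z <= N (mids e) * norm1 z.
  move=> zZ; have [le1|gt1] := leqP (mids e) 1.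
    apply: pairing_le => g; apply: le_trans (nested_kernel_le e g) _.
    by rewrite /N; case: (mids e) le1 => [|[|]] // _ /=; lra.
  have -> : pairing (nested_kernel e) z = pairing (flat_kernel e) z.
    rewrite -[LHS]addr0 -(pairing_gradient (flat_kernel_gradient e) zZ).
    by rewrite -pairingDl; apply: eq_bigr => g _; rewrite addrC subrK.
  apply: pairing_le => g; apply: le_trans (flat_kernel_le e g) _.
  by rewrite /N; case: (mids e) gt1 => [|[|]] // k _ /=; lra.
have sumN : \sum_(e : edge (laakso n)) (1 / 2) ^+ mids e * N (mids e) =
    7 / 6 * 4 ^+ n - 7 / 6 * 2 ^+ n - 1 / 6 * (n%:R * 2 ^+ n).
  rewrite -sum_half_mids -sum_half_mids1 -sum_half_mids0 !mulr_sumr -!sumrB.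
  by apply: eq_bigr => e _; rewrite /N; move: (_ ^+ _) => x; ring.
suff : n%:R * 4 ^+ n / 2 <=
    op_norm1 Q * (7 / 6 * 4 ^+ n - 7 / 6 * 2 ^+ n - 1 / 6 * (n%:R * 2 ^+ n)).
  lra.
(* The trace is bounded row by row: row [e] is paired with the image of the basis vector at [e],
   which lies in the cycle space and has norm at most that of [Q]. *)
rewrite -trace -sumN mulr_sumr; apply: ler_sum => e _.
have -> : pairing (fun f => \sum_i h i e * s i f) (Q (delta_edge R e)) =
    (1 / 2) ^+ mids e * pairing (nested_kernel e) (Q (delta_edge R e)).
  by rewrite mulr_sumr; apply: eq_bigr => f _; rewrite -hs mulrA.
rewrite mulrCA ler_wpM2l ?exprn_ge0 //; first lra.
have QZ : Q (delta_edge R e) \in cycle_space R (laakso n).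
  by rewrite -imQ memv_img // memvf.
rewrite (le_trans (kernel_le e _ QZ)) // mulrC ler_wpM2r ?norm1_delta_le_op //.
by rewrite /N; case: (mids e) => [|[|k]] /=; lra.
Qed.

End LaaksoKernels.

(** * The final numerical estimate *)

Lemma exp2_polynomial_bound n : (7 * 2 ^ n <= n * 2 ^ n + n.+1 * (n + 7))%N.
Proof.
(* From 7 on the first summand suffices; the seven smaller cases are computed. *)
have [n7|n7] := leqP 7 n.
  exact: leq_trans (leq_mul n7 (leqnn _)) (leq_addr _ _).
by do 7?case: n n7 => // n n7.
Qed.

Theorem theorem15 (R : realType) (n : nat) (hn : (1 <= n)%N)
    (Q : 'End(edge_space R (laakso n)))
    (hQ : is_projection_onto Q (cycle_space R (laakso n))) :
  3%:R / 8%:R * n.+1%:R <= op_norm1 Q.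
Proof.
set D : R := 7 * 4 ^+ n - 7 * 2 ^+ n - n%:R * 2 ^+ n.
have n1 : 1 <= n%:R :> R by rewrite ler1n.
have exp4 : 4 ^+ n = 2 ^+ n * 2 ^+ n :> R.
  by rewrite -exprMn; congr (_ ^+ _); ring.
have exp2_gt : n%:R + 1 <= 2 ^+ n :> R by rewrite natr1 -natrX ler_nat ltn_expl.
have D_gt0 : 0 < D by rewrite /D exp4; nra.
(* Up to the factor [2 ^+ n], this is the remaining inequality
   [n.+1%:R * D <= 8 * n%:R * 4 ^+ n]. *)
have poly : 7 * 2 ^+ n <= n%:R * 2 ^+ n + n.+1%:R * (n%:R + 7) :> R.
  rewrite -natrX -!natrM -[7]/(7%:R) -!natrD -natrM -natrD ler_nat.
  exact: exp2_polynomial_bound.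
rewrite -(ler_pM2r D_gt0) (le_trans _ (projection_norm_bound hQ)) //.
by rewrite /D exp4; move: poly; rewrite -natr1; nra.
Qed.
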